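(* Let $N\ge 2$, $R>0$, $\Omega\in\mathcal{C}_R$, and let $f$ be continuous and bounded in $\Omega$. Let $H:\Omega\times\mathbb{R}^N\to\mathbb{R}$ be continuous with $|H(x,\xi)|\le b|\xi|$ for all $(x,\xi)\in\Omega\times\mathbb{R}^N$, where $b\ge 0$ is a constant with $bR<1$. Then every viscosity solution $u$ of $$\mathcal{P}^-_1(D^2u)+H(x,\nabla u)=f(x)\ \text{ in }\Omega,\qquad u=0\ \text{ on }\partial\Omega,$$ and every viscosity solution $u$ of $$\mathcal{P}^+_1(D^2u)+H(x,\nabla u)=f(x)\ \text{ in }\Omega,\qquad u=0\ \text{ on }\partial\Omega,$$ is Lipschitz continuous in $\overline\Omega$. The Lipschitz norm of $u$ can be bounded by a constant depending only on $\Omega$, $b$ and the $L^\infty$ norms of $u$ and $f$.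
   Context: For a real symmetric $N\times N$ matrix $X$, $\mathcal{P}^-_1(X)$ is its smallest eigenvalue and $\mathcal{P}^+_1(X)$ its largest eigenvalue. $B_R(y)$ is the open ball of radius $R$ centred at $y$; $\mathcal{C}_R$ is the class of bounded domains $\Omega\subset\mathbb{R}^N$ such that $\Omega=\bigcap_{y\in Y}B_R(y)$ for some $Y\subset\mathbb{R}^N$. Viscosity solutions: $u$ is a subsolution (resp. supersolution) of $F(x,u,\nabla u,D^2u)=0$ in $\Omega$ if it is upper (resp. lower) semicontinuous and, for every $x\in\Omega$ and every $C^2$ function $\varphi$ touching $u$ from above (resp. below) at $x$, $F(x,u(x),\nabla\varphi(x),D^2\varphi(x))\ge 0$ (resp. $\le 0$). A continuous function is a solution if it is both. Solutions of the Dirichlet problems are continuous on $\overline\Omega$ and vanish on $\partial\Omega$. *)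

(* Defs.v *)
From mathcomp Require Import all_boot all_order all_algebra.
From mathcomp Require Import all_classical all_reals all_analysis.

Set Implicit Arguments.
Unset Strict Implicit.
Unset Printing Implicit Defensive.

Import Order.TTheory GRing.Theory Num.Theory.
Import numFieldNormedType.Exports.

Local Open Scope classical_set_scope.
Local Open Scope ring_scope.

(* The norm of the library on 'rV[R]_N is the max norm; it induces the usual
   topology, but balls, the growth of H and Lipschitz constants are Euclidean. *)
Definition enorm {R : realType} {N : nat} (x : 'rV[R]_N) : R :=
  Num.sqrt (\sum_(i < N) x 0 i ^+ 2).

Definition eball {R : realType} {N : nat} (y : 'rV[R]_N) (r : R) :
    set 'rV[R]_N :=
  [set x | enorm (x - y) < r].

Definition domain {R : realType} {N : nat} (Omega : set 'rV[R]_N) : Prop :=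
  [/\ open Omega, Omega !=set0 & connected Omega].

(* The class C_r. *)
Definition ball_convex {R : realType} {N : nat} (r : R)
    (Omega : set 'rV[R]_N) : Prop :=
  [/\ domain Omega, bounded_set Omega &
      exists Y : set 'rV[R]_N, Omega = \bigcap_(y in Y) eball y r].

Definition boundary {R : realType} {N : nat} (A : set 'rV[R]_N) :
    set 'rV[R]_N :=
  closure A `\` interior A.

(* For a symmetric matrix of positive size the set of eigenvalues is finite
   and nonempty, so that inf and sup are a minimum and a maximum. *)
Definition P1m {R : realType} {N : nat} (X : 'M[R]_N) : R :=
  inf [set a : R | eigenvalue X a].

Definition P1p {R : realType} {N : nat} (X : 'M[R]_N) : R :=
  sup [set a : R | eigenvalue X a].

Definition partial {R : realType} {N : nat} (i : 'I_N) (phi : 'rV[R]_N -> R) :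
    'rV[R]_N -> R :=
  fun x => 'D_(delta_mx 0 i) phi x.

Definition gradient {R : realType} {N : nat} (phi : 'rV[R]_N -> R)
    (x : 'rV[R]_N) : 'rV[R]_N :=
  \row_i partial i phi x.

Definition hessian {R : realType} {N : nat} (phi : 'rV[R]_N -> R)
    (x : 'rV[R]_N) : 'M[R]_N :=
  \matrix_(i, j) partial j (partial i phi) x.

Definition C2_on {R : realType} {N : nat} (U : set 'rV[R]_N)
    (phi : 'rV[R]_N -> R) : Prop :=
  forall x, U x ->
  [/\ {for x, continuous phi},
      forall i, derivable phi x (delta_mx 0 i),
      forall i, {for x, continuous (partial i phi)},
      forall i j, derivable (partial i phi) x (delta_mx 0 j) &
      forall i j, {for x, continuous (partial j (partial i phi))}].

Definition C2_near {R : realType} {N : nat} (x : 'rV[R]_N)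
    (phi : 'rV[R]_N -> R) : Prop :=
  exists U : set 'rV[R]_N, [/\ open U, U x & C2_on U phi].

Definition touches_above {R : realType} {N : nat} (phi u : 'rV[R]_N -> R)
    (x : 'rV[R]_N) : Prop :=
  phi x = u x /\ \forall y \near x, u y <= phi y.

Definition touches_below {R : realType} {N : nat} (phi u : 'rV[R]_N -> R)
    (x : 'rV[R]_N) : Prop :=
  phi x = u x /\ \forall y \near x, phi y <= u y.

Definition usc_on {R : realType} {N : nat} (A : set 'rV[R]_N)
    (u : 'rV[R]_N -> R) : Prop :=
  forall x, A x -> forall a, u x < a -> \forall y \near within A (nbhs x), u y < a.

Definition lsc_on {R : realType} {N : nat} (A : set 'rV[R]_N)
    (u : 'rV[R]_N -> R) : Prop :=
  forall x, A x -> forall a, a < u x -> \forall y \near within A (nbhs x), a < u y.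

Definition viscosity_subsolution {R : realType} {N : nat}
    (F : 'rV[R]_N -> R -> 'rV[R]_N -> 'M[R]_N -> R)
    (Omega : set 'rV[R]_N) (u : 'rV[R]_N -> R) : Prop :=
  usc_on Omega u /\
  forall x phi, Omega x -> C2_near x phi -> touches_above phi u x ->
    0 <= F x (u x) (gradient phi x) (hessian phi x).

Definition viscosity_supersolution {R : realType} {N : nat}
    (F : 'rV[R]_N -> R -> 'rV[R]_N -> 'M[R]_N -> R)
    (Omega : set 'rV[R]_N) (u : 'rV[R]_N -> R) : Prop :=
  lsc_on Omega u /\
  forall x phi, Omega x -> C2_near x phi -> touches_below phi u x ->
    F x (u x) (gradient phi x) (hessian phi x) <= 0.

Definition viscosity_solution {R : realType} {N : nat}
    (F : 'rV[R]_N -> R -> 'rV[R]_N -> 'M[R]_N -> R)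
    (Omega : set 'rV[R]_N) (u : 'rV[R]_N -> R) : Prop :=
  [/\ {within Omega, continuous u}, viscosity_subsolution F Omega u &
      viscosity_supersolution F Omega u].

(* P(D^2 u) + H(x, grad u) = f in Omega, u = 0 on the boundary of Omega. *)
Definition dirichlet_solution {R : realType} {N : nat}
    (P : 'M[R]_N -> R) (H : 'rV[R]_N -> 'rV[R]_N -> R) (f : 'rV[R]_N -> R)
    (Omega : set 'rV[R]_N) (u : 'rV[R]_N -> R) : Prop :=
  [/\ {within closure Omega, continuous u},
      viscosity_solution (fun x _ xi X => P X + H x xi - f x) Omega u &
      forall x, boundary Omega x -> u x = 0].

(* The L^infinity norm on Omega; used only for continuous bounded functions on
   an open set, for which the essential supremum is the supremum. *)
Definition Linfty_norm {R : realType} {N : nat} (Omega : set 'rV[R]_N)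
    (f : 'rV[R]_N -> R) : R :=
  sup [set `|f x| | x in Omega].

Definition lipschitz_continuous_on {R : realType} {N : nat}
    (A : set 'rV[R]_N) (u : 'rV[R]_N -> R) : Prop :=
  exists L : R, forall x y, A x -> A y -> `|u x - u y| <= L * enorm (x - y).

(* sup |u| + sup |u x - u y| / |x - y|. The pairs with x = y contribute
   0 / 0 = 0 to the second supremum. *)
Definition lipschitz_norm {R : realType} {N : nat}
    (A : set 'rV[R]_N) (u : 'rV[R]_N -> R) : \bar R :=
  (ereal_sup [set `|u x|%:E | x in A] +
   ereal_sup [set (`|u p.1 - u p.2| / enorm (p.1 - p.2))%:E | p in A `*` A])%E.

(* Main.v *)
Require Import Defs.
From mathcomp Require Import all_boot all_order all_algebra.
From mathcomp Require Import all_classical all_reals all_analysis.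
From mathcomp Require Import ring lra.
Import Order.TTheory GRing.Theory Num.Theory.
Import numFieldNormedType.Exports.
Local Open Scope classical_set_scope.
Local Open Scope ring_scope.

(** The two problems are exchanged by [u := - u], because
[P1p (- X) = - P1m X]; so let [u] solve the one with the smallest
eigenvalue, and write [K] for the supremum of [|f|]. By the growth condition
on [H], only two inequalities are needed: every test function touching [u]
from above has [- K <= P1m (D^2 phi) + b |D phi|], and every one touching
[- u] from above has [- K <= P1p (D^2 phi) + b |D phi|].

Boundary estimate ([paraboloid_barrier], [le_distance_boundary]). Let
[B_r(y)] be one of the balls whose intersection is [Omega]. The function
[C / 2 (r^2 - |x - y|^2)] is nonnegative on the closure of [Omega], its Hessian
is [- C] times the identity and its gradient is at most [C r] in norm. As
[b r < 1], the choice [C (1 - b r) > K] makes it a strict supersolution of the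
second inequality, hence it lies above [- u]. A boundary point [z] is outside
some [B_r(y)], and with this [y] the bound reads [- u x <= C r |z - x|].

Interior estimate ([cone_barrier]). Fix [y] in the closure of [Omega]. The
function [u y + g |x - y|], where [g t = A / l (1 - exp (- l t))] and
[l = b + 1], has the eigenvalue [g''] in the radial direction away from [y], and
[g'' + b g' = - A exp (- l t)]. For [A] large with respect to [K] and to the
diameter it is thus a strict supersolution of the first inequality outside [y].
It equals [u] at [y], and it is nonnegative on the boundary by the boundary
estimate, so it lies above [u]. Since [g t <= A t] this gives
[u x - u y <= A |x - y|] for all [x] and [y] ([one_sided_lipschitz]). *)

(** * The Euclidean norm *)

(** The square of [enorm]. Radial functions are written as functions of it,
since it is smooth at the centre. *)
Definition sqn {R : realType} {N : nat} (x : 'rV[R]_N) : R :=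
  \sum_(i < N) x 0 i ^+ 2.

Section EuclideanNorm.
Context {R : realType} {N : nat}.
Implicit Types x y v : 'rV[R]_N.

Lemma sqn_ge0 x : 0 <= sqn x.
Proof. by apply: sumr_ge0 => i _; exact: sqr_ge0. Qed.

Lemma enorm_ge0 x : 0 <= enorm x.
Proof. exact: sqrtr_ge0. Qed.

Lemma sqr_enorm x : enorm x ^+ 2 = sqn x.
Proof. by rewrite sqr_sqrtr // sqn_ge0. Qed.

Lemma sqn_eq0 x : (sqn x == 0) = (x == 0).
Proof.
apply/eqP/eqP => [/eqP|->]; last first.
  by rewrite /sqn big1 // => i _; rewrite mxE expr0n.
rewrite psumr_eq0 => [/allP h|i _]; last exact: sqr_ge0.
apply/rowP => i; rewrite mxE; apply/eqP.
by rewrite -sqrf_eq0; apply: h; rewrite mem_index_enum.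
Qed.

Lemma sqn_gt0 x : (0 < sqn x) = (x != 0).
Proof. by rewrite lt_def sqn_eq0 sqn_ge0 andbT. Qed.

Lemma enorm_gt0 x : (0 < enorm x) = (x != 0).
Proof. by rewrite sqrtr_gt0 -/(sqn x) sqn_gt0. Qed.

Lemma enorm0 : enorm (0 : 'rV[R]_N) = 0.
Proof. by apply/eqP; rewrite eq_le enorm_ge0 leNgt enorm_gt0 eqxx. Qed.

Lemma enormZ (c : R) x : enorm (c *: x) = `|c| * enorm x.
Proof.
rewrite /enorm -sqrtr_sqr -sqrtrM ?sqr_ge0 // mulr_sumr; congr Num.sqrt.
by apply: eq_bigr => i _; rewrite mxE exprMn.
Qed.

Lemma enormN x : enorm (- x) = enorm x.
Proof. by rewrite -scaleN1r enormZ normrN1 mul1r. Qed.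

Lemma enorm_distC x y : enorm (x - y) = enorm (y - x).
Proof. by rewrite -enormN opprB. Qed.

Lemma sqnD x y : sqn (x + y) = sqn x + 2 * (\sum_i x 0 i * y 0 i) + sqn y.
Proof.
rewrite /sqn mulr_sumr -!big_split /=; apply: eq_bigr => i _.
by rewrite mxE; ring.
Qed.

(** Cauchy-Schwarz, by expanding the square of [|y| x - |x| y]. *)
Lemma dot_le_enorm x y : \sum_i x 0 i * y 0 i <= enorm x * enorm y.
Proof.
have [->|x0] := eqVneq x 0.
  by rewrite enorm0 mul0r big1 // => i _; rewrite mxE mul0r.
have [->|y0] := eqVneq y 0.
  by rewrite enorm0 mulr0 big1 // => i _; rewrite mxE mulr0.
have xp : 0 < enorm x by rewrite enorm_gt0.
have yp : 0 < enorm y by rewrite enorm_gt0.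
have := sqn_ge0 (enorm y *: x + (- enorm x) *: y).
rewrite sqnD -!(sqr_enorm (_ *: _)) !enormZ !exprMn !real_normK ?num_real //.
under eq_bigr do rewrite !mxE.
have -> : \sum_i enorm y * x 0 i * (- enorm x * y 0 i) =
   - (enorm x * enorm y) * \sum_i x 0 i * y 0 i.
  by rewrite mulr_sumr; apply: eq_bigr => i _; ring.
set s := (\sum_i _) => h.
have {h} : 0 <= (enorm x * enorm y) * (enorm x * enorm y - s) by lra.
by rewrite pmulr_rge0 ?mulr_gt0 // subr_ge0.
Qed.

Lemma ler_enormD x y : enorm (x + y) <= enorm x + enorm y.
Proof.
rewrite -(@ler_pXn2r _ 2) ?nnegrE ?addr_ge0 ?enorm_ge0 //.
rewrite sqr_enorm sqnD -!sqr_enorm.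
by have := dot_le_enorm x y; lra.
Qed.

Lemma continuous_coordB y i : continuous (fun x => (x - y) 0 i).
Proof.
have -> : (fun x => (x - y) 0 i) = (fun x => x 0 i - y 0 i).
  by apply: funext => x; rewrite !mxE.
by move=> x; apply: continuousB;
  [exact: coord_continuous|exact: cst_continuous].
Qed.

Lemma continuous_sqnB y : continuous (fun x => sqn (x - y)).
Proof.
apply: continuous_big => [|i _ x]; first exact: add_continuous.
by under eq_fun do rewrite expr2; apply: continuousM; exact: continuous_coordB.
Qed.

Lemma enorm_bounded (A : set 'rV[R]_N) : bounded_set A ->
  exists2 D, 0 <= D & forall x y, A x -> A y -> enorm (x - y) <= D.
Proof.
move=> [M [Mr HM]].
pose m := `|M| + 1.
have {}HM z : A z -> `|z| <= m.
  by apply: HM; rewrite /m (le_lt_trans (ler_norm M)) // ltrDl.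
exists (Num.sqrt (\sum_(i < N) (m + m) ^+ 2)); first exact: sqrtr_ge0.
move=> x y Ax Ay; apply: ler_wsqrtr; apply: ler_sum => i _.
have h z : A z -> `|z 0 i| <= m.
  move=> Az; apply: le_trans (HM _ Az).
  rewrite [leRHS]/Num.Def.normr /= mx_normrE.
  exact: (le_bigmax _ (fun k : 'I_1 * 'I_N => `|z k.1 k.2|) (0, i)).
rewrite !mxE -[leLHS]real_normK ?num_real //.
apply: lerXn2r; rewrite ?nnegrE //.
  by rewrite /m addr_ge0 ?addr_ge0.
by rewrite (le_trans (ler_normB _ _)) // lerD // h.
Qed.

End EuclideanNorm.

(** * Radial test functions *)

Section Radial.
Context {R : realType}.

(** Reduces directional derivatives to derivatives in one real variable, for
which there is a chain rule. *)
Lemma is_derive_line (V : normedModType R) (f : V -> R) (x v : V) (l : R) :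
  is_derive (0 : R) 1 (fun h => f (h *: v + x)) l -> is_derive x v f l.
Proof.
have E : (fun h : R => h^-1 *: (((fun k => f (k *: v + x)) \o shift 0) (h *: 1)
             - (fun k => f (k *: v + x)) 0)) =
   (fun h : R => h^-1 *: ((f \o shift x) (h *: v) - f x)).
  by apply: funext => h /=; rewrite scale0r add0r addr0 [h *: 1]mulr1.
move=> [d0 dl]; split; first by move: d0; rewrite /derivable E.
by rewrite -dl /derive E.
Qed.

Lemma near_eq_continuous (T : topologicalType) (f g : T -> R) (x : T) :
  (\forall z \near x, f z = g z) ->
  {for x, continuous f} -> {for x, continuous g}.
Proof.
move=> fg; have E : f x = g x := nbhs_singleton fg.
by rewrite /prop_for /continuous_at -E; apply: cvg_trans; exact: near_eq_cvg.
Qed.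

(** The set [V] is the half-line of positive numbers for cones, which are singular at their
vertex, and the whole line for paraboloids. *)
Definition C2_profile (V : set R) (F F1 F2 : R -> R) : Prop :=
  open V /\ forall s, V s ->
  [/\ is_derive s 1 F (F1 s), is_derive s 1 F1 (F2 s) & {for s, continuous F2}].

Definition radial {N} (F : R -> R) (y x : 'rV[R]_N) : R := F (sqn (x - y)).

Context (N : nat) (y : 'rV[R]_N) (V : set R) (F F1 F2 : R -> R).
Context (FV : C2_profile V F F1 F2).

Let U : set 'rV[R]_N := [set x | V (sqn (x - y))].

Lemma open_radial : open U.
Proof.
by apply: open_comp; [move=> x _; exact: continuous_sqnB|exact: FV.1].
Qed.

Lemma is_derive_radial (G : R -> R) (l : R) (x : 'rV[R]_N) i :
  is_derive (sqn (x - y)) 1 G l ->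
  is_derive x (delta_mx 0 i) (radial G y) (2 * l * (x - y) 0 i).
Proof.
move=> dG; apply: is_derive_line.
set d := x - y.
pose p := fun h : R => sqn d + (2 * d 0 i) * h + h ^+ 2.
have -> : (fun h => radial G y (h *: delta_mx 0 i + x)) = G \o p.
  apply: funext => h; rewrite /radial /= -addrA -/d addrC sqnD /p; congr G.
  congr (_ + _ + _).
    rewrite (bigD1 i) //= big1 ?addr0 => [|k ki];
      first by rewrite !mxE !eqxx /=; ring.
    by rewrite !mxE (negbTE ki) andbF !mulr0.
  rewrite /sqn (bigD1 i) //= big1 ?addr0 => [|k ki];
    first by rewrite !mxE !eqxx mulr1.
  by rewrite !mxE (negbTE ki) andbF mulr0 expr0n.
have p0 : p 0 = sqn d by rewrite /p expr0n mulr0 !addr0.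
have dp : is_derive (0 : R) 1 p (2 * d 0 i).
  apply: is_derive_eq.
  by rewrite !scale0r !addr0 add0r mul1r [LHS]mulr1.
rewrite -p0 in dG.
by apply: is_derive_eq (is_derive1_comp dG dp) _; rewrite mulrCA mulrA.
Qed.

Lemma is_derive_coordB (x : 'rV[R]_N) i j :
  is_derive x (delta_mx 0 j) (fun z => (z - y) 0 i) (i == j)%:R.
Proof.
apply: is_derive_line.
have -> : (fun h : R => (h *: delta_mx 0 j + x - y) 0 i) =
          (fun h => h * (i == j)%:R + (x - y) 0 i).
  by apply: funext => h; rewrite !mxE eqxx /= addrA.
apply: is_derive_eq.
by rewrite addr0 scaler0 add0r [LHS]mulr1.
Qed.

Lemma near_radial (x : 'rV[R]_N) : U x -> \forall z \near x, U z.
Proof. by move=> Ux; apply: open_nbhs_nbhs; split => //; exact: open_radial. Qed.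

Lemma partial_radial (x : 'rV[R]_N) i : U x ->
  partial i (radial F y) x = 2 * F1 (sqn (x - y)) * (x - y) 0 i.
Proof.
by move=> Ux; have [/(is_derive_radial _ _ _ i)[]] := FV.2 _ Ux.
Qed.

Lemma is_derive_partial_radial (x : 'rV[R]_N) i j : U x ->
  is_derive x (delta_mx 0 j) (partial i (radial F y))
    (4 * F2 (sqn (x - y)) * (x - y) 0 i * (x - y) 0 j
      + 2 * F1 (sqn (x - y)) * (i == j)%:R).
Proof.
move=> Ux.
have d1 : is_derive x (delta_mx 0 j)
   ((cst 2 * radial F1 y) * (fun z => (z - y) 0 i))
   (4 * F2 (sqn (x - y)) * (x - y) 0 i * (x - y) 0 j
      + 2 * F1 (sqn (x - y)) * (i == j)%:R).
  have [_ /(is_derive_radial _ _ _ j) d1 _] := FV.2 _ Ux.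
  have d2 := is_derive_coordB x i j.
  apply: is_derive_eq.
  have -> : (cst 2 * radial F1 y) x = 2 * F1 (sqn (x - y)) by [].
  by rewrite -![_ *: _]/(_ * _) /radial; ring.
apply: near_eq_is_derive d1.
by near=> z; rewrite partial_radial //; near: z; exact: near_radial.
Unshelve. all: by end_near. Qed.

Lemma gradient_radial (x : 'rV[R]_N) : U x ->
  gradient (radial F y) x = (2 * F1 (sqn (x - y))) *: (x - y).
Proof.
by move=> Ux; apply/rowP => i; rewrite mxE partial_radial // [RHS]mxE.
Qed.

Lemma hessian_radial (x : 'rV[R]_N) : U x ->
  hessian (radial F y) x = (2 * F1 (sqn (x - y)))%:M
     + (4 * F2 (sqn (x - y))) *: ((x - y)^T *m (x - y)).
Proof.
move=> Ux; apply/matrixP => i j.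
rewrite mxE /partial -/(partial _ _).
have [_ ->] := is_derive_partial_radial _ i j Ux.
by rewrite !mxE big_ord1 !mxE -mulr_natr; ring.
Qed.

Lemma continuous_radial (G : R -> R) (x : 'rV[R]_N) :
  {for sqn (x - y), continuous G} -> {for x, continuous (radial G y)}.
Proof.
by move=> cG; apply: continuous_comp => //; exact: continuous_sqnB.
Qed.

Lemma C2_radial (x : 'rV[R]_N) : U x -> C2_near x (radial F y).
Proof.
move=> Ux; exists U; split => //; first exact: open_radial.
move=> {Ux}x Ux; have [dF dF1 cF2] := FV.2 _ Ux.
have cF : {for sqn (x - y), continuous F}.
  by apply/differentiable_continuous/derivable1_diffP.
have cF1 : {for sqn (x - y), continuous F1}.
  by apply/differentiable_continuous/derivable1_diffP.
split.
- exact: continuous_radial.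
- by move=> i; have [] := is_derive_radial _ _ _ i dF.
- move=> i.
  apply: (@near_eq_continuous _
      ((cst 2 \* radial F1 y) \* (fun z => (z - y) 0 i))).
    by near=> z; rewrite partial_radial //; near: z; exact: near_radial.
  apply: continuousM; last exact: continuous_coordB.
  by apply: continuousM; [exact: cst_continuous|exact: continuous_radial].
- by move=> i j; have [] := is_derive_partial_radial _ i j Ux.
move=> i j.
apply: (@near_eq_continuous _
    (((cst 4 \* radial F2 y) \* (fun z => (z - y) 0 i))
        \* (fun z => (z - y) 0 j)
      + (cst 2 \* radial F1 y) \* cst (i == j)%:R)).
  near=> z; have Uz : U z by near: z; exact: near_radial.
  by have [_ Ez] := is_derive_partial_radial _ i j Uz; rewrite [partial j _ z]Ez.
apply: continuousD.
  apply: continuousM; last exact: continuous_coordB.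
  apply: continuousM; last exact: continuous_coordB.
  by apply: continuousM; [exact: cst_continuous|exact: continuous_radial].
apply: continuousM; last exact: cst_continuous.
by apply: continuousM; [exact: cst_continuous|exact: continuous_radial].
Unshelve. all: by end_near. Qed.

End Radial.

(** * Extreme eigenvalues *)

Section ExtremeEigenvalues.
Context {R : realType}.

(** Makes the infimum in [P1m] a genuine lower bound: compare the l1 norms of
the two sides of the eigenvector equation. *)
Lemma eigenvalue_bound N (X : 'M[R]_N) a : eigenvalue X a ->
  `|a| <= \sum_i \sum_j `|X i j|.
Proof.
move=> /eigenvalueP[v vX v0].
have vpos : 0 < \sum_i `|v 0 i|.
  rewrite lt_def sumr_ge0 // andbT; apply: contra v0.
  rewrite psumr_eq0 => [/allP h|//]; apply/eqP/rowP => i; rewrite mxE.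
  by apply/eqP; rewrite -normr_eq0; apply: h; rewrite mem_index_enum.
rewrite -(ler_pM2r vpos) mulr_sumr.
have -> : \sum_i `|a| * `|v 0 i| = \sum_j `|(v *m X) 0 j|.
  by apply: eq_bigr => j _; rewrite vX mxE normrM.
apply: (@le_trans _ _ (\sum_j \sum_i `|v 0 i| * `|X i j|)).
  apply: ler_sum => j _; rewrite mxE; apply: le_trans (ler_norm_sum _ _ _) _.
  by apply: ler_sum => i _; rewrite normrM.
rewrite exchange_big /= mulr_suml; apply: ler_sum => i _.
rewrite -mulr_sumr mulrC; apply: ler_wpM2l; first exact: sumr_ge0.
by rewrite (bigD1 i) //= lerDl sumr_ge0.
Qed.

Lemma P1m_le_eigenvalue N (X : 'M[R]_N) a : eigenvalue X a -> P1m X <= a.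
Proof.
move=> Xa; apply: ge_inf => //; exists (- \sum_i \sum_j `|X i j|).
by move=> c /eigenvalue_bound; rewrite ler_norml => /andP[].
Qed.

Lemma eigenvalueN N (X : 'M[R]_N) a : eigenvalue X a -> eigenvalue (- X) (- a).
Proof.
move=> /eigenvalueP[v vX v0]; apply/eigenvalueP; exists v => //.
by rewrite mulmxN vX scaleNr.
Qed.

Lemma P1mN N (X : 'M[R]_N) : P1m (- X) = - P1p X.
Proof.
rewrite /P1m /P1p /inf; congr (- sup _); apply/seteqP; split => a /=.
  by move=> [c Xc <-]; rewrite -[X]opprK; exact: eigenvalueN.
by move=> Xa; exists (- a); [exact: eigenvalueN|rewrite opprK].
Qed.

Lemma P1pN N (X : 'M[R]_N) : P1p (- X) = - P1m X.
Proof. by rewrite -[in RHS](opprK X) P1mN opprK. Qed.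

Lemma P1p_scalar N (c : R) : (0 < N)%N -> P1p (c%:M : 'M[R]_N) = c.
Proof.
case: N => // N _; rewrite /P1p.
suff -> : [set a | eigenvalue (c%:M : 'M[R]_N.+1) a] = [set c].
  exact: sup1.
apply/seteqP; split => a /=.
  move=> /eigenvalueP[v]; rewrite mul_mx_scalar => /eqP.
  by rewrite -subr_eq0 -scalerBl scaler_eq0 subr_eq0 => /orP[/eqP//|->].
move=> ->; apply/eigenvalueP; exists (const_mx 1); first exact: mul_mx_scalar.
by apply/eqP => /rowP/(_ 0); rewrite !mxE => /eqP; rewrite oner_eq0.
Qed.

End ExtremeEigenvalues.

(** * Changing the sign of a solution *)

Section Negation.
Context {R : realType} {N : nat}.
Implicit Types (phi u : 'rV[R]_N -> R) (x : 'rV[R]_N).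

Lemma partialN phi x i : derivable phi x (delta_mx 0 i) ->
  partial i (fun z => - phi z) x = - partial i phi x.
Proof. exact: deriveN. Qed.

Lemma gradientN (U : set 'rV[R]_N) phi x : C2_on U phi -> U x ->
  gradient (fun z => - phi z) x = - gradient phi x.
Proof.
move=> UC Ux; have [_ d1 _ _ _] := UC x Ux.
by apply/rowP => i; rewrite !mxE partialN.
Qed.

(** A second derivative sees [partial i] on a neighbourhood, so the sign rule
is needed near [x] and not only at [x]. *)
Lemma near_partialN (U : set 'rV[R]_N) phi x i : open U -> C2_on U phi -> U x ->
  \forall z \near x, - partial i phi z = partial i (fun z => - phi z) z.
Proof.
move=> oU UC Ux; have nU : \forall z \near x, U z by exact: open_nbhs_nbhs.
near=> z; have Uz : U z by near: z.
by have [_ d1 _ _ _] := UC z Uz; rewrite partialN.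
Unshelve. all: by end_near. Qed.

Lemma is_derive_partialN (U : set 'rV[R]_N) phi x i j :
  open U -> C2_on U phi -> U x ->
  is_derive x (delta_mx 0 j) (partial i (fun z => - phi z))
    (- partial j (partial i phi) x).
Proof.
move=> oU UC Ux; have [_ _ _ d2 _] := UC x Ux.
apply: near_eq_is_derive (near_partialN _ _ _ i oU UC Ux) _.
by apply: is_deriveN; exact/derivableP.
Qed.

Lemma hessianN (U : set 'rV[R]_N) phi x : open U -> C2_on U phi -> U x ->
  hessian (fun z => - phi z) x = - hessian phi x.
Proof.
move=> oU UC Ux; apply/matrixP => i j; rewrite !mxE /partial.
by have [_ ->] := is_derive_partialN _ _ _ i j oU UC Ux.
Qed.

Lemma C2_onN (U : set 'rV[R]_N) phi : open U -> C2_on U phi ->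
  C2_on U (fun z => - phi z).
Proof.
move=> oU UC x Ux; have [c0 d1 c1 d2 c2] := UC x Ux; split.
- exact: continuousN.
- by move=> i; exact: derivableN.
- move=> i; apply: near_eq_continuous (near_partialN _ _ _ i oU UC Ux) _.
  exact: continuousN.
- by move=> i j; have [] := is_derive_partialN _ _ _ i j oU UC Ux.
move=> i j; apply: (@near_eq_continuous _ _ (fun z => - partial j (partial i phi) z)).
  have nU : \forall z \near x, U z by exact: open_nbhs_nbhs.
  near=> z; have Uz : U z by near: z.
  by have [_ E] := is_derive_partialN _ _ _ i j oU UC Uz; rewrite [RHS]E.
exact: continuousN.
Unshelve. all: by end_near. Qed.

Lemma viscosity_supersolutionN F (Omega : set 'rV[R]_N) u :
  viscosity_supersolution F Omega u ->
  viscosity_subsolution (fun x s xi X => - F x (- s) (- xi) (- X)) Omega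
    (fun z => - u z).
Proof.
move=> [lu Fu]; split.
  move=> x Ox a ua; have : - a < u x by rewrite ltrNl.
  move=> /(lu _ Ox); apply: filterS => y ay; by rewrite ltrNl.
move=> x phi Ox [U [oU Ux UC]] [Ex phiu].
rewrite oppr_ge0 opprK -(gradientN _ _ _ UC Ux) -(hessianN _ _ _ oU UC Ux).
apply: (Fu x (fun z => - phi z) Ox);
  first by exists U; split; [| |exact: C2_onN].
by split; [rewrite Ex opprK|apply: filterS phiu => y; rewrite lerNl].
Qed.

End Negation.

(** * Comparison with radial functions *)

Section Comparison.
Context {R : realType} {N : nat}.
Implicit Types (u : 'rV[R]_N -> R) (x y : 'rV[R]_N) (Omega : set 'rV[R]_N).

(** At a point where [u - radial F y] is maximal over the compact closure, a
vertical translate of the radial function touches [u] from above. If the maximum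
is positive this point is not on the boundary. The viscosity inequality there
then contradicts [radial F y] being a strict supersolution. *)
Lemma touching_radial Omega u y (F : R -> R) x : open Omega ->
  compact (closure Omega) -> {within closure Omega, continuous u} ->
  continuous F -> (forall z, boundary Omega z -> u z <= radial F y z) ->
  closure Omega x -> radial F y x < u x ->
  exists z c, [/\ Omega z, radial F y z < u z &
    touches_above (radial (fun s => F s + c) y) u z].
Proof.
move=> oO cO cu cF bd Ox Fu.
have cr : continuous (radial F y).
  by move=> z; apply: continuous_radial; exact: cF.
have cd : {within closure Omega, continuous (fun z => u z - radial F y z)}.
  by move=> z; apply: continuousB; [exact: cu|exact: continuous_subspaceT].
have [z /set_mem Oz zmax] := EVT_max_rV (ex_intro _ x Ox) cO cd.
have Fz : radial F y z < u z.
  by rewrite -subr_gt0 (lt_le_trans _ (zmax x (mem_set Ox))) // subr_gt0.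
have Omz : Omega z.
  apply: contrapT => nO; move: Fz; rewrite ltNge bd //.
  by split => //; rewrite (proj1 (interior_id _) oO).
exists z, (u z - radial F y z); split => //; split.
  by rewrite {1}/radial -/(radial F y z) addrC subrK.
have nO : \forall w \near z, Omega w by exact: open_nbhs_nbhs.
near=> w; have Ow : Omega w by near: w.
have /= := zmax w (mem_set (subset_closure Ow)).
rewrite -[X in _ -> _ <= X]/(radial F y w + (u z - radial F y z)) /=; lra.
Unshelve. all: by end_near. Qed.

End Comparison.

(** What remains of the equation once [H] and [f] are replaced by their bounds. *)
Definition extremal_subsolution {R : realType} {N : nat} (P : 'M[R]_N -> R)
    (K b : R) (Omega : set 'rV[R]_N) (u : 'rV[R]_N -> R) : Prop :=
  viscosity_subsolution (fun _ _ xi X => P X + b * enorm xi + K) Omega u.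

(** * Barriers *)

Section Barriers.
Context {R : realType} {N : nat}.
Implicit Types (u : 'rV[R]_N -> R) (x y : 'rV[R]_N) (Omega : set 'rV[R]_N).

Lemma bounded_closure (A : set 'rV[R]_N) :
  bounded_set A -> bounded_set (closure A).
Proof.
move=> [M [Mr HM]]; exists M; split => // m Mm.
suff : closure A `<=` [set x | `|x| <= m] by [].
have cl : closed [set x : 'rV[R]_N | `|x| <= m].
  apply: (@preimage_closed _ _ (fun x : 'rV[R]_N => `|x|) [set s | s <= m]).
    by move=> x _; exact: norm_continuous.
  exact: closed_le.
rewrite ((closure_id _).1 cl); apply: closure_subset => x Ax; exact: HM.
Qed.

Lemma compact_closure (A : set 'rV[R]_N) :
  bounded_set A -> compact (closure A).
Proof.
move=> bA; apply: bounded_closed_compact; last exact: closed_closure.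
exact: bounded_closure.
Qed.

Lemma closure_eball (A : set 'rV[R]_N) y r : A `<=` eball y r ->
  closure A `<=` [set x | enorm (x - y) <= r].
Proof.
move=> Ar x Ax.
have r0 : 0 <= r.
  have [z [Az _]] := Ax setT filterT.
  by rewrite (le_trans (enorm_ge0 (z - y))) // ltW //; exact: Ar.
have cl : closed [set x | sqn (x - y) <= r ^+ 2].
  apply: (@preimage_closed _ _ (fun x => sqn (x - y)) [set s | s <= r ^+ 2]).
    by move=> z _; exact: continuous_sqnB.
  exact: closed_le.
have : closure A `<=` [set x | sqn (x - y) <= r ^+ 2].
  rewrite ((closure_id _).1 cl); apply: closure_subset => z /Ar zr /=.
  rewrite -sqr_enorm lerXn2r ?nnegrE ?enorm_ge0 //; exact: ltW.
move=> /(_ _ Ax) /=.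
by rewrite -sqr_enorm ler_pXn2r // nnegrE enorm_ge0.
Qed.

Lemma C2_profile_affine (a c : R) :
  C2_profile setT (fun s => a * s + c) (cst a) (cst 0).
Proof.
split; first exact: openT.
move=> s _; split; [|exact: is_derive_cst|exact: cst_continuous].
by apply: is_derive_eq; rewrite addr0 [LHS]mulr1.
Qed.

(** The Hessian of the paraboloid is a multiple of the identity, so its
smallest and largest eigenvalues agree, and [b * r < 1] lets the second order
term win over the gradient term, whose size is at most [b * (C * r)]. *)
Lemma paraboloid_barrier (K b r C : R) Omega u y : (0 < N)%N ->
  0 <= b -> 0 <= C -> K < C * (1 - b * r) ->
  open Omega -> bounded_set Omega -> Omega `<=` eball y r ->
  {within closure Omega, continuous u} ->
  (forall z, boundary Omega z -> u z = 0) ->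
  extremal_subsolution P1p K b Omega u ->
  forall x, closure Omega x -> u x <= C / 2 * (r ^+ 2 - sqn (x - y)).
Proof.
move=> N0 b0 C0 KC oO bO Or cu u0 [_ su] x Ox; rewrite leNgt; apply/negP => ux.
have Ocl := closure_eball _ _ _ Or.
pose F s : R := - (C / 2) * s + C / 2 * r ^+ 2.
have FE z : radial F y z = C / 2 * (r ^+ 2 - sqn (z - y)).
  by rewrite /radial /F; ring.
have sqn_le z : closure Omega z -> sqn (z - y) <= r ^+ 2.
  move=> /Ocl zr; have r0 : 0 <= r := le_trans (enorm_ge0 _) zr.
  by rewrite -sqr_enorm lerXn2r ?nnegrE ?enorm_ge0.
rewrite -FE in ux.
have cF : continuous F.
  move=> s; apply/differentiable_continuous/derivable1_diffP.
  by have [[]] := (C2_profile_affine (- (C / 2)) (C / 2 * r ^+ 2)).2 s I.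
have bd z : boundary Omega z -> u z <= radial F y z.
  move=> bz; rewrite u0 // FE mulr_ge0 ?divr_ge0 // subr_ge0.
  by apply: sqn_le; case: bz.
have [z [c [Oz Fz tz]]] :=
  touching_radial _ _ _ _ _ oO (compact_closure _ bO) cu cF bd Ox ux.
have FC : C2_profile setT (fun s => F s + c) (cst (- (C / 2))) (cst 0).
  have := C2_profile_affine (- (C / 2)) (C / 2 * r ^+ 2 + c).
  by congr C2_profile; apply: funext => s; rewrite /F addrA.
have := su z _ Oz (C2_radial _ _ _ _ _ _ FC z I) tz.
rewrite (gradient_radial _ _ _ _ _ _ FC z I) (hessian_radial _ _ _ _ _ _ FC z I) /=.
rewrite mulr0 scale0r addr0 P1p_scalar // enormZ.
have -> : 2 * - (C / 2) = - C by field.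
rewrite normrN ger0_norm //.
have zr := Ocl _ (subset_closure Oz).
have : b * (C * enorm (z - y)) <= b * (C * r) by rewrite ler_wpM2l // ler_wpM2l.
lra.
Qed.

(** As a function of [s = t ^+ 2]: the concave profile
[h + A / l * (1 - exp (- l t))] of a cone-like barrier with vertex value [h] and
slope [A] at the vertex. *)
Definition cone_profile (A l h s : R) : R :=
  h + A / l * (1 - expR (- (l * Num.sqrt s))).

Lemma C2_profile_cone A l h : l != 0 ->
  C2_profile [set s | 0 < s] (cone_profile A l h)
    (fun s => A * expR (- (l * Num.sqrt s)) / (2 * Num.sqrt s))
    (fun s => - A * expR (- (l * Num.sqrt s)) * (l * Num.sqrt s + 1)
                / (4 * Num.sqrt s ^+ 3)).
Proof.
move=> l0; split; first exact: open_gt.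
move=> s /= s0.
have t0 : Num.sqrt s != 0 by rewrite gt_eqF // sqrtr_gt0.
have ds := is_derive1_sqrt s0.
have dt : is_derive s 1 (fun s => - (l * Num.sqrt s)) (- (l / (2 * Num.sqrt s))).
  by apply: is_derive_eq; rewrite -[_ *: _]/(_ * _).
have de : is_derive s 1 (fun s => expR (- (l * Num.sqrt s)))
    (expR (- (l * Num.sqrt s)) * - (l / (2 * Num.sqrt s))).
  exact: (is_derive1_comp (is_derive_expR _) dt).
have dv : is_derive s 1 (fun s => (2 * Num.sqrt s)^-1) (- (4 * Num.sqrt s ^+ 3)^-1).
  have d2 : is_derive s 1 (fun s => 2 * Num.sqrt s) (Num.sqrt s)^-1.
    by apply: is_derive_eq; rewrite -[_ *: _]/(_ * _); field.
  have t2 : 2 * Num.sqrt s != 0 by rewrite mulf_neq0.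
  apply: is_derive_eq (@is_deriveV _ (fun s => 2 * Num.sqrt s) s _ 1 t2 d2) _.
  by rewrite -[_ *: _]/(_ * _); field.
split.
- by apply: is_derive_eq; rewrite -![_ *: _]/(_ * _); field; rewrite t0.
- by apply: is_derive_eq; rewrite -![_ *: _]/(_ * _); field.
apply: continuousM; last first.
  apply: continuousV; first by rewrite /= mulf_neq0 // expf_neq0.
  apply: continuousM; first exact: cst_continuous.
  apply: (@continuous_comp _ _ _ Num.sqrt (fun t : R => t ^+ 3)).
    exact: sqrt_continuous.
  exact: exprn_continuous.
apply: continuousM.
  apply: continuousM; first exact: cst_continuous.
  apply: differentiable_continuous; apply/derivable1_diffP.
  by case: de.
apply: continuousD; last exact: cst_continuous.
by apply: continuousM; [exact: cst_continuous|exact: sqrt_continuous].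
Qed.

Lemma continuous_cone A l h : continuous (cone_profile A l h).
Proof.
have cl : continuous (fun s : R => - (l * Num.sqrt s)).
  move=> s; under eq_fun do rewrite -mulNr.
  have ch : {for s, continuous (cst (- l) \* @Num.sqrt R)}.
    by apply: continuousM; [exact: cst_continuous|exact: sqrt_continuous].
  exact: ch.
have ce : continuous (fun s : R => expR (- (l * Num.sqrt s))).
  move=> s; apply: (@continuous_comp _ _ _ (fun s => - (l * Num.sqrt s)) expR).
    exact: cl.
  exact: continuous_expR.
have cF : continuous
    (cst h + cst (A / l) \* (cst 1 - fun s : R => expR (- (l * Num.sqrt s)))).
  move=> s; apply: continuousD; first exact: cst_continuous.
  apply: continuousM; first exact: cst_continuous.
  by apply: continuousB; [exact: cst_continuous|exact: ce].
exact: cF.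
Qed.

Lemma cone_profile_le A l h x : 0 <= A -> 0 < l ->
  radial (cone_profile A l h) 0 x <= h + A * enorm x.
Proof.
move=> A0 l0; rewrite /radial subr0 /cone_profile -/(enorm x) lerD2l.
rewrite -mulrA ler_wpM2l // mulrC ler_pdivrMr //.
by have := expR_ge1Dx (- (l * enorm x)); lra.
Qed.

Lemma cone_profile_ge A l h x : 0 <= A -> 0 < l ->
  h + A * expR (- (l * enorm x)) * enorm x <= radial (cone_profile A l h) 0 x.
Proof.
move=> A0 l0; rewrite /radial subr0 /cone_profile -/(enorm x) lerD2l.
rewrite -!mulrA ler_wpM2l // [leRHS]mulrC ler_pdivlMr //.
have := expR_ge1Dx (l * enorm x).
rewrite -(ler_pM2l (expR_gt0 (- (l * enorm x)))) -expRD addNr expR0.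
lra.
Qed.

(** The radial vector [z - y] is an eigenvector of the Hessian, which bounds the
smallest eigenvalue by the second derivative of the profile. The other
eigenvalues are positive and may be large, so this works for [P1m] only. The
exponential absorbs a gradient term of any strength [b], and the behaviour of
[u] at the boundary enters through [L]. *)
Lemma cone_barrier (K b L D : R) Omega u y :
  0 <= K -> 0 <= b -> 0 <= L -> open Omega -> bounded_set Omega ->
  (forall x y, closure Omega x -> closure Omega y -> enorm (x - y) <= D) ->
  {within closure Omega, continuous u} ->
  (forall z, boundary Omega z -> u z = 0) ->
  extremal_subsolution P1m K b Omega u ->
  closure Omega y ->
  (forall z, boundary Omega z -> - u y <= L * enorm (z - y)) ->
  forall x, closure Omega x ->
    u x <= u y + (L + K + 1) * expR ((b + 1) * D) * enorm (x - y).
Proof.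
move=> K0 b0 L0 oO bO hD cu u0 [_ su] Oy low x Ox.
set A := (L + K + 1) * expR _; pose l := b + 1.
have l0 : 0 < l by rewrite /l ltr_wpDl.
have A0 : 0 <= A by rewrite mulr_ge0 ?expR_ge0 // !addr_ge0.
(* The factor exp (l D) in A makes the slope of the profile at least
   L + K + 1 up to distance D. *)
have Aexp z : closure Omega z -> L + K + 1 <= A * expR (- (l * enorm (z - y))).
  move=> Oz; rewrite /A -mulrA -expRD ler_peMr ?addr_ge0 //.
  rewrite -[leLHS]expR0 ler_expR subr_ge0 ler_wpM2l ?hD //; exact: ltW.
pose F := cone_profile A l (u y).
have FE z : radial F y z = radial F 0 (z - y) by rewrite /radial subr0.
suff : u x <= radial F y x.
  by move=> h; apply: (le_trans h); rewrite FE; exact: cone_profile_le.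
rewrite leNgt; apply/negP => ux.
have bd z : boundary Omega z -> u z <= radial F y z.
  move=> bz; rewrite u0 // FE (le_trans _ (cone_profile_ge _ _ _ _ A0 l0)) //.
  have := low z bz.
  have : L * enorm (z - y) <= A * expR (- (l * enorm (z - y))) * enorm (z - y).
    rewrite ler_wpM2r ?enorm_ge0 // (le_trans _ (Aexp _ bz.1)) // -addrA lerDl.
    by rewrite addr_ge0.
  lra.
have [z [c [Oz Fz tz]]] := touching_radial _ _ _ _ _ oO (compact_closure _ bO)
  cu (continuous_cone A l (u y)) bd Ox ux.
(* The barrier equals u at y, so the touching point is not the vertex. *)
have zy : z - y != 0.
  apply: contraTneq Fz => zy; rewrite FE zy /radial subr0.
  rewrite (_ : z = y); last by apply/eqP; rewrite -subr_eq0 zy.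
  rewrite /F /cone_profile -[sqn 0]sqr_enorm enorm0 expr0n sqrtr0 mulr0 oppr0.
  by rewrite expR0 subrr mulr0 addr0 ltxx.
have s0 : 0 < sqn (z - y) by rewrite sqn_gt0.
have FC := C2_profile_cone A l (u y + c) (lt0r_neq0 l0).
have FcE : (fun s => F s + c) = cone_profile A l (u y + c).
  by apply: funext => s; rewrite /F /cone_profile addrAC.
rewrite FcE in tz.
have := su z _ Oz (C2_radial _ _ _ _ _ _ FC z s0) tz.
rewrite (gradient_radial _ _ _ _ _ _ FC z s0) (hessian_radial _ _ _ _ _ _ FC z s0).
rewrite -/(enorm (z - y)); set t := enorm (z - y); set e := expR _.
have t0 : 0 < t by rewrite enorm_gt0.
have e0 : 0 < e by exact: expR_gt0.
rewrite enormZ -/t ger0_norm; last first.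
  by apply: mulr_ge0 => //; apply: divr_ge0; apply: mulr_ge0 => //; exact: ltW.
(* 2 F' + 4 s F'' at s = t ^+ 2 is the second derivative of the profile in t. *)
have ev : eigenvalue ((2 * (A * e / (2 * t)))%:M
     + (4 * (- A * e * (l * t + 1) / (4 * t ^+ 3))) *: ((z - y)^T *m (z - y)))
     (- (l * (A * e))).
  apply/eigenvalueP; exists (z - y) => //.
  rewrite mulmxDr mul_mx_scalar -scalemxAr mulmxA.
  rewrite (_ : (z - y) *m (z - y)^T = (t ^+ 2)%:M); last first.
    apply/matrixP => i j; rewrite !ord1 sqr_enorm !mxE /= mulr1n.
    by apply: eq_bigr => k _; rewrite [X in _ * X]mxE expr2.
  rewrite mul_scalar_mx scalerA -scalerDl; congr (_ *: _).
  by field; rewrite gt_eqF.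
have := P1m_le_eigenvalue _ _ _ ev.
have := Aexp z (subset_closure Oz); rewrite -/t -/e.
have -> : 2 * (A * e / (2 * t)) * t = A * e by field; rewrite gt_eqF.
rewrite /l; set m := P1m _; lra.
Qed.

End Barriers.

(** * The Lipschitz estimate *)

Section Lipschitz.
Context {R : realType} {N : nat}.
Implicit Types (u : 'rV[R]_N -> R) (x y : 'rV[R]_N) (Omega : set 'rV[R]_N).

(** The boundary point [z] is outside one of the balls [B_r(y)]. Then
[r ^+ 2 - |x - y| ^+ 2 <= 2 r (r - |x - y|)] and [r - |x - y| <= |z - x|]. *)
Lemma le_distance_boundary (K b r C : R) (Y : set 'rV[R]_N) u
    (Omega := \bigcap_(y in Y) eball y r) :
  (0 < N)%N -> 0 <= b -> 0 <= C -> K < C * (1 - b * r) ->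
  open Omega -> bounded_set Omega ->
  {within closure Omega, continuous u} ->
  (forall z, boundary Omega z -> u z = 0) ->
  extremal_subsolution P1p K b Omega u ->
  forall x z, closure Omega x -> boundary Omega z ->
    u x <= C * r * enorm (z - x).
Proof.
move=> N0 b0 C0 KC oO bO cu u0 su x z Ox bz.
have nOz : ~ Omega z by case: bz; rewrite (proj1 (interior_id _) oO).
have [y Yy rz] : exists2 y, Y y & r <= enorm (z - y).
  apply: contrapT => nY; apply: nOz => y Yy; rewrite /eball /= ltNge.
  by apply/negP => rz; apply: nY; exists y.
have Oy : Omega `<=` eball y r by move=> w; exact.
have := paraboloid_barrier _ _ _ _ _ _ _ N0 b0 C0 KC oO bO Oy cu u0 su x Ox.
move=> /le_trans; apply.
have xr := closure_eball _ _ _ Oy x Ox; rewrite /= in xr.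
have tri := ler_enormD (z - x) (x - y); rewrite addrA subrK in tri.
have s0 := enorm_ge0 (x - y); have t0 := enorm_ge0 (z - x).
rewrite -sqr_enorm.
have {rz tri} h : r <= enorm (z - x) + enorm (x - y) := le_trans rz tri.
move: (enorm (x - y)) (enorm (z - x)) xr s0 t0 h => s t sr s0 t0 h.
have : 0 <= C * ((t - (r - s)) * (r + s) + t * (r - s)).
  by apply: mulr_ge0 => //; apply: addr_ge0; apply: mulr_ge0; lra.
lra.
Qed.

Lemma one_sided_lipschitz (K b r C D : R) (Y : set 'rV[R]_N) u
    (Omega := \bigcap_(y in Y) eball y r) :
  (0 < N)%N -> 0 <= K -> 0 <= b -> 0 <= r -> 0 <= C -> K < C * (1 - b * r) ->
  open Omega -> bounded_set Omega ->
  (forall x y, closure Omega x -> closure Omega y -> enorm (x - y) <= D) ->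
  {within closure Omega, continuous u} ->
  (forall z, boundary Omega z -> u z = 0) ->
  extremal_subsolution P1m K b Omega u ->
  extremal_subsolution P1p K b Omega (fun z => - u z) ->
  forall x y, closure Omega x -> closure Omega y ->
    u x - u y <= (C * r + K + 1) * expR ((b + 1) * D) * enorm (x - y).
Proof.
move=> N0 K0 b0 r0 C0 KC oO bO hD cu u0 sm sp x y Ox Oy.
rewrite lerBlDl;
apply: (cone_barrier _ _ _ _ _ _ _ K0 b0 _ oO bO hD cu u0 sm Oy _ x Ox).
  exact: mulr_ge0.
move=> z bz.
apply: (le_distance_boundary _ _ _ _ _ _ N0 b0 C0 KC oO bO _ _ sp y z Oy bz).
  by move=> w; apply: continuousN; exact: cu.
by move=> w bw; rewrite u0 // oppr0.
Qed.

Lemma viscosity_subsolution_le F G Omega u :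
  (forall x xi X, Omega x -> F x (u x) xi X <= G x (u x) xi X) ->
  viscosity_subsolution F Omega u -> viscosity_subsolution G Omega u.
Proof.
move=> FG [uu Fu]; split => // x phi Ox C2 t.
by apply: le_trans (Fu x phi Ox C2 t) _; exact: FG.
Qed.

Lemma le_Linfty_norm Omega (f : 'rV[R]_N -> R) x :
  [bounded f x | x in Omega] -> Omega x -> `|f x| <= Linfty_norm Omega f.
Proof.
move=> [M [Mr HM]] Ox; apply: ub_le_sup; last by exists x.
exists (M + 1) => _ [z Oz <-]; apply: (HM (M + 1)) => //.
by rewrite ltrDl.
Qed.

Section Solutions.
Context (H : 'rV[R]_N -> 'rV[R]_N -> R) (f : 'rV[R]_N -> R).
Context (Omega : set 'rV[R]_N) (b K : R).
Context (Hb : forall x xi, Omega x -> `|H x xi| <= b * enorm xi).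
Context (fK : forall x, Omega x -> `|f x| <= K).

Lemma subsolution_extremal P u :
  viscosity_subsolution (fun x _ xi X => P X + H x xi - f x) Omega u ->
  extremal_subsolution P K b Omega u.
Proof.
apply: viscosity_subsolution_le => x xi X Ox.
have := Hb x xi Ox; have := fK x Ox; rewrite !ler_norml => /andP[? ?] /andP[? ?].
lra.
Qed.

Lemma supersolution_extremal P Q u : (forall X, P (- X) = - Q X) ->
  viscosity_supersolution (fun x _ xi X => P X + H x xi - f x) Omega u ->
  extremal_subsolution Q K b Omega (fun z => - u z).
Proof.
move=> PQ /viscosity_supersolutionN.
apply: viscosity_subsolution_le => x xi X Ox.
have := Hb x (- xi) Ox; have := fK x Ox; rewrite PQ enormN !ler_norml.
move=> /andP[? ?] /andP[? ?].
lra.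
Qed.

End Solutions.

Lemma lipschitz_norm_le Omega u (a L : R) : 0 <= L ->
  (forall x, Omega x -> `|u x| <= a) ->
  (forall x y, Omega x -> Omega y -> `|u x - u y| <= L * enorm (x - y)) ->
  (lipschitz_norm Omega u <= (a + L)%:E)%E.
Proof.
move=> L0 ua uL; rewrite /lipschitz_norm EFinD; apply: leeD.
  by apply: ge_ereal_sup => _ [x Ox <-]; rewrite lee_fin ua.
apply: ge_ereal_sup => _ [[x y] [/= Ox Oy] <-]; rewrite lee_fin.
have [->|xy] := eqVneq x y; first by rewrite !subrr enorm0 invr0 mulr0.
by rewrite ler_pdivrMr ?enorm_gt0 ?subr_eq0 // uL.
Qed.

End Lipschitz.

Theorem proposition3p1 (R : realType) (N : nat) (hN : (2 <= N)%N)
    (r : R) (hr : 0 < r) (Omega : set 'rV[R]_N) (hOmega : ball_convex r Omega)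
    (b : R) (hb : 0 <= b) (hbr : b * r < 1) :
  exists C : R -> R -> R,
  forall (f : 'rV[R]_N -> R) (H : 'rV[R]_N -> 'rV[R]_N -> R),
    {within Omega, continuous f} ->
    [bounded f x | x in Omega] ->
    {within Omega `*` [set: 'rV[R]_N],
      continuous (fun p : 'rV[R]_N * 'rV[R]_N => H p.1 p.2)} ->
    (forall x xi, Omega x -> `|H x xi| <= b * enorm xi) ->
  forall u : 'rV[R]_N -> R,
    dirichlet_solution P1m H f Omega u \/ dirichlet_solution P1p H f Omega u ->
    lipschitz_continuous_on (closure Omega) u /\
    (lipschitz_norm (closure Omega) u
       <= (C (Linfty_norm Omega u) (Linfty_norm Omega f))%:E)%E.
Proof.
have N0 : (0 < N)%N by exact: ltnW.
move: hOmega => [[oO [x0 Ox0] _] bO [Y OY]].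
have [D D0 hD] := enorm_bounded _ (bounded_closure _ bO).
(* With C := c K the gap in K < C * (1 - b * r) is exactly 1. *)
pose c (K : R) := (K + 1) / (1 - b * r).
pose L (K : R) := (c K * r + K + 1) * expR ((b + 1) * D).
exists (fun a K => a + L K) => f H _ fb _ Hb u hu.
pose K := Linfty_norm Omega f.
have fK x : Omega x -> `|f x| <= K by exact: le_Linfty_norm.
have K0 : 0 <= K := le_trans (normr_ge0 _) (fK _ Ox0).
have br : 0 < 1 - b * r by rewrite subr_gt0.
have c0 : 0 <= c K by apply: divr_ge0; [exact: addr_ge0|exact: ltW].
have Kc : K < c K * (1 - b * r) by rewrite divfK ?gt_eqF // ltrDl.
have L0 : 0 <= L K by rewrite mulr_ge0 ?expR_ge0 // !addr_ge0 // mulr_ge0 // ltW.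
have cu : {within closure Omega, continuous u} by case: hu => [] [].
have u0 z : boundary Omega z -> u z = 0 by case: hu => [] [_ _ +]; exact.
have cNu : {within closure Omega, continuous (fun z => - u z)}.
  by move=> w; apply: continuousN; exact: cu.
have Nu0 z : boundary Omega z -> - u z = 0 by move=> bz; rewrite u0 ?oppr0.
have key w : {within closure Omega, continuous w} ->
    (forall z, boundary Omega z -> w z = 0) ->
    extremal_subsolution P1m K b Omega w ->
    extremal_subsolution P1p K b Omega (fun z => - w z) ->
    forall x y, closure Omega x -> closure Omega y ->
      w x - w y <= L K * enorm (x - y).
  move=> cw w0 sm sp x y Ox Oy; have r0 := ltW hr.
  by move: oO bO hD cw w0 sm sp Ox Oy; rewrite OY => *;
    apply: (one_sided_lipschitz K b r (c K) D Y w).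
have uL x y : closure Omega x -> closure Omega y ->
    `|u x - u y| <= L K * enorm (x - y).
  have sym w : (forall x y, closure Omega x -> closure Omega y ->
        w x - w y <= L K * enorm (x - y)) ->
      closure Omega x -> closure Omega y -> `|w x - w y| <= L K * enorm (x - y).
    move=> wL Ox Oy; rewrite ler_norml wL // andbT lerNl opprB enorm_distC.
    exact: wL.
  case: hu => -[_ [_ sub sup] _].
    apply: sym; apply: key => //.
      exact: (subsolution_extremal _ _ _ _ _ Hb fK).
    exact: (supersolution_extremal _ _ _ _ _ Hb fK _ _ _ (@P1mN R N) sup).
  move=> Ox Oy; have -> : `|u x - u y| = `|- u x - - u y|.
    by rewrite -opprD normrN.
  apply: (sym (fun z => - u z)) => //; apply: key => //.
    exact: (supersolution_extremal _ _ _ _ _ Hb fK _ _ _ (@P1pN R N) sup).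
  rewrite (_ : (fun z => - - u z) = u); last first.
    by apply: funext => z; rewrite opprK.
  exact: (subsolution_extremal _ _ _ _ _ Hb fK).
split; first by exists (L K) => x y; exact: uL.
have ub : [bounded u x | x in Omega].
  have [M [Mr HM]] := compact_bounded
    (continuous_compact cu (compact_closure _ bO)).
  exists M; split => // m Mm z Oz; apply: (HM m Mm).
  by exists z => //; exact: subset_closure.
apply: lipschitz_norm_le => // x Ox.
have [Omx|nO] := pselect (Omega x); first exact: le_Linfty_norm.
rewrite u0; first by rewrite normr0 (le_trans (normr_ge0 (u x0))) // le_Linfty_norm.
by split => //; rewrite (proj1 (interior_id _) oO).
Qed.
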